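(* Let $X$ be a regular $P$-space. (1) If $X$ satisfies ${}^{*}U_{fin}(\mathcal{O},\Omega)$ and $Y$ is an infinite closed and discrete subset of $X$, then $|Y|<\mathrm{cof}(\mathrm{Fin}(w(X))^{\mathbb{N}})$. (2) If $X$ is star-Lindelöf or satisfies ${}^{*}U_{fin}(\mathcal{O},\Omega)$, and $w(X)=\mathfrak{c}$, then every closed and discrete subset of $X$ has cardinality less than $\mathfrak{c}$.
   Context: Regular spaces are assumed to be $T_1$. A $P$-space is a space in which every $G_\delta$ set is open. $w(X)$ denotes the weight of $X$ and $\mathfrak{c}$ is the cardinality of $\mathbb{R}$. For $A\subseteq X$ and a family $\mathcal{P}$ of subsets of $X$, $St(A,\mathcal{P})=\bigcup\{B\in\mathcal{P} : A\cap B\neq\emptyset\}$. $X$ is star-Lindelöf if for every open cover $\mathcal{U}$ of $X$ there is a countable $\mathcal{V}\subseteq\mathcal{U}$ with $St(\bigcup\mathcal{V},\mathcal{U})=X$. An $\omega$-cover of $X$ is an open cover $\mathcal{U}$ such that every finite $F\subseteq X$ is contained in some member of $\mathcal{U}$. $X$ satisfies ${}^{*}U_{fin}(\mathcal{O},\Omega)$ if for each sequence $(\mathcal{U}_n)_{n\in\mathbb{N}}$ of open covers of $X$ there are finite $\mathcal{V}_n\subseteq\mathcal{U}_n$ $(n\in\mathbb{N})$ such that $\{St(\bigcup_{m\in\mathbb{N}}(\bigcup\mathcal{V}_m),\mathcal{U}_n) : n\in\mathbb{N}\}$ is an $\omega$-cover of $X$. For an infinite set (or cardinal) $\kappa$,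 $\mathrm{Fin}(\kappa)$ is the set of all finite subsets of $\kappa$, and $\mathrm{Fin}(\kappa)^{\mathbb{N}}$, the set of all functions $f:\mathbb{N}\to\mathrm{Fin}(\kappa)$, is partially ordered by $f\leq g$ iff $f(n)\subseteq g(n)$ for all $n\in\mathbb{N}$. $\mathrm{cof}(\mathrm{Fin}(\kappa)^{\mathbb{N}})$ is the cofinality of $(\mathrm{Fin}(\kappa)^{\mathbb{N}},\leq)$, i.e. the least cardinality of a cofinal subset. *)

(* Defs.v *)
From HB Require Import structures.
From mathcomp Require Import all_boot all_order all_algebra.
From mathcomp Require Import all_classical all_reals all_analysis.
From mathcomp Require Import borel_hierarchy.

Set Implicit Arguments.
Unset Strict Implicit.
Unset Printing Implicit Defensive.

Local Open Scope classical_set_scope.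
Local Open Scope card_scope.

Definition card_lt T U (A : set T) (B : set U) : Prop := (A #<= B) /\ ~ (B #<= A).
Notation "A '#<' B" := (card_lt A B) (at level 79) : card_scope.

(* Cardinals are represented by sets up to [#=].  [min_card F] is a member of
   the nonempty family [F] of least cardinality; see [min_cardP]. *)
Definition min_card T (F : set (set T)) : set T :=
  get [set A | F A /\ forall B, F B -> A #<= B].

(* Zorn on the sets of choice functions for [F] that are pairwise distinct at
   every member of [F]: a maximal one exhausts some member of [F]. *)
Lemma ex_min_card T (F : set (set T)) : F !=set0 ->
  exists A, F A /\ forall B, F B -> A #<= B.
Proof.
move=> [A0 FA0].
pose P (S : set (set T -> T)) :=
  (forall c A, S c -> F A -> A (c A)) /\
  (forall c c' A, S c -> S c' -> F A -> c A = c' A -> c = c').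
have [G PG Gtot|S [[Sin Sinj] Smax]] := @Zorn_bigcup _ P.
  split=> [c A [X GX Xc] FA|c c' A [X GX Xc] [Y GY Yc'] FA e].
    by have [inX _] := PG _ GX; exact: (inX _ _ Xc FA).
  have [XY|YX] := Gtot _ _ GX GY.
    by have [_ injY] := PG _ GY; exact: (injY _ _ _ (XY _ Xc) Yc' FA e).
  by have [_ injX] := PG _ GX; exact: (injX _ _ _ Xc (YX _ Yc') FA e).
have [[A FA AS]|nA] := pselect
    (exists2 A, F A & forall x, A x -> exists2 c, S c & c A = x).
  exists A; split=> // B FB.
  have /choice[h hP] x : exists c, A x -> S c /\ c A = x.
    have [/AS[c Sc cA]|nAx] := pselect (A x); first by exists c.
    by exists (fun=> x) => /nAx.
  suff /injfunPex/unsquash f : exists2 f, set_fun A B f & set_inj A f.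
    exact: inj_card_le f.
  exists (fun x => h x B); first by move=> x /hP[Sh _]; exact: (Sin _ _ Sh FB).
  move=> x y /set_mem/hP[Sx ex] /set_mem/hP[Sy ey] /(Sinj _ _ _ Sx Sy FB) e.
  by rewrite -ex -ey e.
have miss A : F A -> exists x, A x /\ forall c, S c -> c A <> x.
  move=> FA; apply: contrapT => h; apply: nA; exists A => // x Ax.
  apply: contrapT => h'; apply: h; exists x; split=> // c Sc e.
  by apply: h'; exists c.
have [x0 _] := miss _ FA0.
have /choice[d dP] A : exists x, F A -> A x /\ forall c, S c -> c A <> x.
  have [/miss[x]|nFA] := pselect (F A); first by exists x.
  by exists x0 => /nFA.
exfalso; apply: (Smax (S `|` [set d])).
  split; first by move=> c Sc; left.
  move=> /(_ d (or_intror erefl)) Sd.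
  by have [_ /(_ _ Sd)] := dP _ FA0.
split=> [c A [Sc|->] FA|c c' A [Sc|->] [Sc'|->] FA //].
- exact: (Sin _ _ Sc FA).
- by have [] := dP _ FA.
- exact: Sinj.
- by have [_ /(_ _ Sc)] := dP _ FA.
- by have [_ /(_ _ Sc')] := dP _ FA => h /esym.
Qed.

Lemma min_cardP T (F : set (set T)) : F !=set0 ->
  F (min_card F) /\ forall B, F B -> min_card F #<= B.
Proof.
move=> /ex_min_card[A hA].
exact: (@getI _ [set A | F A /\ forall B, F B -> A #<= B] A hA).
Qed.

Section cofinality.
Context {T : Type}.
Implicit Types (P : set T) (le : T -> T -> Prop).

Definition cofinal_in P le : set (set T) :=
  [set D | D `<=` P /\ forall x, P x -> exists2 y, D y & le x y].

Definition cof P le : set T := min_card (cofinal_in P le).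

Lemma cofP P le : (forall x, P x -> le x x) ->
  cofinal_in P le (cof P le) /\
  forall D, cofinal_in P le D -> cof P le #<= D.
Proof.
move=> lexx; apply: min_cardP; exists P; split=> // x Px.
by exists x => //; exact: lexx.
Qed.

End cofinality.

Section Fin.
Context {T : Type}.
Implicit Types (kappa : set T) (f g : nat -> set T).

Definition Fin kappa : set (set T) :=
  [set F | finite_set F /\ F `<=` kappa].

Definition FinN kappa : set (nat -> set T) :=
  [set f | forall n, Fin kappa (f n)].

Definition FinN_le f g : Prop := forall n, f n `<=` g n.

Definition cof_FinN kappa : set (nat -> set T) := cof (FinN kappa) FinN_le.

End Fin.

Definition weight (X : topologicalType) : set (set X) :=
  min_card [set B | basis B].
Arguments weight : clear implicits.

Lemma weightP (X : topologicalType) : basis (weight X) /\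
  forall B : set (set X), basis B -> weight X #<= B.
Proof.
apply: min_cardP; exists open; split=> // x A.
by rewrite nbhsE => -[U [oU Ux] UA]; exists U.
Qed.

Definition P_space (X : topologicalType) : Prop :=
  forall A : set X, Gdelta A -> open A.

Section star.
Context {X : topologicalType}.
Implicit Types (A Y : set X) (U V : set (set X)).

Definition star A U : set X :=
  \bigcup_(B in [set B | U B /\ A `&` B !=set0]) B.

Definition open_cover U : Prop := U `<=` open /\ \bigcup_(B in U) B = setT.

Definition omega_cover U : Prop := open_cover U /\
  forall F : set X, finite_set F -> exists2 B, U B & F `<=` B.

Definition closed_discrete Y : Prop := closed Y /\ Y `<=` isolated Y.

End star.

Definition star_Lindelof (X : topologicalType) : Prop :=
  forall U : set (set X), open_cover U ->
  exists V : set (set X), [/\ V `<=` U, countable V &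
    star (\bigcup_(B in V) B) U = setT].

Definition star_Ufin_O_Omega (X : topologicalType) : Prop :=
  forall U : nat -> set (set X), (forall n, open_cover (U n)) ->
  exists V : nat -> set (set X),
    (forall n, finite_set (V n) /\ V n `<=` U n) /\
    omega_cover (range (fun n =>
      star (\bigcup_m \bigcup_(B in V m) B) (U n))).

(* Main.v *)
Require Import Defs.
From mathcomp Require Import all_boot all_order all_algebra.
From mathcomp Require Import all_classical all_reals all_analysis.
From mathcomp Require Import lra.

(* Applying the hypothesis to a constant sequence of covers, both star
   properties give that X is star-Lindelöf.  Let Y be infinite closed discrete,
   B a base, D cofinal in Fin(B)^N, and suppose e : D -> Y is injective.
   Each f in D lists countably many base sets; as X is a P-space, e(f) has a
   neighbourhood N(e(f)) missing the closure of every listed set whose closure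
   does not contain e(f).  Cover X by base sets that either lie in some N(y) with
   y in them, or stay away from Y.  Given countably many of these, uncountably
   many f in D list all of them, since D is cofinal; one of these has e(f)
   outside their closures, and then e(f) is not in their star.  So D does not
   inject into Y, whence (1).  For (2), take D to be all of Fin(B)^N, which has
   cardinality at most c when B does. *)

Import Order.TTheory GRing.Theory Num.Theory.

Local Open Scope classical_set_scope.
Local Open Scope card_scope.

(** * Comparison of cardinalities *)

Lemma card_le_injfun {T U} (A : set T) (B : set U) : B !=set0 -> A #<= B ->
  exists2 f : T -> U, set_fun A B f & set_inj A f.
Proof.
elim/Ppointed: U => U in B *; first by rewrite emptyE => -[].
by move=> _ /pcard_leP/injfunPex.
Qed.

Lemma card_le_inj {T U} (A : set T) (B : set U) (f : T -> U) :
  set_fun A B f -> set_inj A f -> A #<= B.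
Proof.
move=> fAB fI; have /injfunPex/unsquash g : exists2 g, set_fun A B g & set_inj A g.
  by exists f.
exact: inj_card_le g.
Qed.

(** Both sets are copied into the sum type, so that the well-ordering of cardinals in [ex_min_card]
    applies to the pair of copies. *)
Lemma card_le_total {T U} (A : set T) (B : set U) : A #<= B \/ B #<= A.
Proof.
have eA : (inl @` A : set (T + U)) #= A.
  by apply: inj_card_eq => x y _ _ [].
have eB : (inr @` B : set (T + U)) #= B.
  by apply: inj_card_eq => x y _ _ [].
pose F : set (set (T + U)) := [set inl @` A; inr @` B].
have [C [FC minC]] := @ex_min_card _ F (ex_intro _ _ (or_introl erefl)).
case: FC minC => -> minC; [left|right].
  by rewrite -(card_le_eql eA) -(card_le_eqr eB); apply: minC; right.
by rewrite -(card_le_eqr eA) -(card_le_eql eB); apply: minC; left.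
Qed.

(* Diagonalization: if [e] numbered these [f], then [g n] could be made to exceed
   all [f n] with [e f <= n]. *)
Lemma cofinal_FinN_uncountable {T} (kappa : set T) D v :
  infinite_set kappa -> cofinal_in (FinN kappa) FinN_le D -> FinN kappa v ->
  ~ countable [set f | D f /\ FinN_le v f].
Proof.
move=> kI [Dk Dcof] kv /countable_injP[e eI].
pose W n := \bigcup_(f in [set f | (D f /\ FinN_le v f) /\ (e f <= n)%N]) f n.
have Wfin n : finite_set (W n).
  apply: bigcup_finite => [|f [[Df _] _]]; last by have [] := Dk _ Df n.
  apply: (@card_le_finite _ _ _ `I_n.+1); last exact: finite_II.
  apply: (@card_le_inj _ _ _ _ e) => [f [_ ef]//|f g /set_mem[Df _] /set_mem[Dg _]].
  by apply: eI; apply/mem_set.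
have /choice[b bP] n : exists x, kappa x /\ ~ W n x.
  by have /infinite_setN0[x []] := infinite_setD kI (Wfin n); exists x.
(* The term [v n] puts any [f] in [D] above [g] among the enumerated functions; then [f n] is
   contained in [W n] for [n = e f], which [b n] contradicts. *)
pose g n := v n `|` (W n `|` [set b n]).
have [n|f Df gf] := Dcof g.
  have [vfin vk] := kv n; split; first by rewrite !finite_setU; split=> //; split.
  move=> x [/vk//|[[f [[/Dk/(_ n)[_ fk] _] _] /fk//]|->]].
  by case: (bP n).
have vf : FinN_le v f by move=> n x vx; apply: gf; left.
have [_] := bP (e f); apply; exists f => //; apply: gf; right; right.
by [].
Qed.

(** * Closed discrete subsets of star-Lindelöf regular P-spaces *)

Section star_Lindelof_closed_discrete.
Context {X : topologicalType}.
Implicit Types (Y : set X) (B : set (set X)).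

Lemma basis_nbhs B x (A : set X) : basis B -> nbhs x A ->
  exists U, [/\ B U, U x & U `<=` A].
Proof. by move=> [_ /(_ x)] /[apply] -[U [BU Ux] UA]; exists U. Qed.

Lemma regular_basis_nbhs B x (A : set X) : regular_space X -> basis B ->
  nbhs x A -> exists U, [/\ B U, U x & closure U `<=` A].
Proof.
move=> regX bB /regX[C /(basis_nbhs _ _ _ bB)[U [BU Ux UC]] CA].
by exists U; split=> // z /(closureS UC)/CA.
Qed.

Lemma isolated_nbhs Y : closed_discrete Y ->
  exists W : X -> set X, forall y, Y y -> nbhs y (W y) /\ W y `&` Y = [set y].
Proof.
move=> [_ Yd]; have /choice[W WP] y : exists V, Y y -> nbhs y V /\ V `&` Y = [set y].
  have [Yy|nYy] := pselect (Y y); last by exists setT => /nYy.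
  by have [_ [V]] := Yd _ Yy; exists V.
by exists W.
Qed.

(** A base set around [y] inside [W y] meets [Y] only in [y], so distinct points get distinct base
    sets. *)
Lemma closed_discrete_card_le_basis Y B : closed_discrete Y -> basis B ->
  Y #<= B.
Proof.
move=> /isolated_nbhs[W WP] bB.
have /choice[c cP] y : exists U, Y y -> [/\ B U, U y & U `<=` W y].
  have [Yy|nYy] := pselect (Y y); last by exists setT => /nYy.
  by have [/(basis_nbhs _ _ _ bB)[U]] := WP _ Yy; exists U.
apply: (@card_le_inj _ _ _ _ c) => [y /cP[]//|y z /set_mem Yy /set_mem Yz cyz].
have [_ cy _] := cP _ Yy; have [_ _ czW] := cP _ Yz.
have : (W z `&` Y) y by split=> //; apply: czW; rewrite -cyz.
by have [_ ->] := WP _ Yz.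
Qed.

Lemma P_space_closed_bigcup (F : nat -> set X) : P_space X ->
  (forall n, closed (F n)) -> closed (\bigcup_n F n).
Proof.
move=> PX Fc; rewrite -openC setC_bigcup; apply: PX.
by exists (fun n => ~` F n) => // n; rewrite openC.
Qed.

Lemma star_Lindelof_cofinal_not_card_le B Y (D : set (nat -> set (set X))) :
  regular_space X -> P_space X -> star_Lindelof X -> basis B ->
  infinite_set Y -> closed_discrete Y ->
  cofinal_in (FinN B) FinN_le D -> ~ (D #<= Y).
Proof.
move=> regX PX SL bB Yinf Ycd Dcof /card_le_injfun[|e eY eI].
  exact: infinite_setN0.
have Binf : infinite_set B.
  move=> Bfin; apply: Yinf; apply: card_le_finite Bfin.
  exact: closed_discrete_card_le_basis.
have [Dk Dc] := Dcof.
have [W WP] := isolated_nbhs _ Ycd.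
(* [g] inverts [e] on its image and lists nothing elsewhere, so that [bad y] is defined for every
   [y]. *)
have /choice[g gP] y : exists g, FinN B g /\ forall f, D f -> e f = y -> g = f.
  have [[f [Df efy]]|nf] := pselect (exists f, D f /\ e f = y).
    exists f; split=> [|f' Df' ef'y]; first exact: Dk.
    by apply: eI; rewrite ?inE// efy.
  exists (fun=> set0); split=> [n|f Df efy]; first by split.
  by exfalso; apply: nf; exists f.
pose bad y := \bigcup_n \bigcup_(C in [set C | g y n C /\ ~ closure C y]) closure C.
have bad_closed y : closed (bad y).
  apply: P_space_closed_bigcup => // n; apply: closed_bigcup => [|C _].
    have [/(_ n)[gfin _] _] := gP y; apply: sub_finite_set gfin.
    by move=> C [].
  exact: closed_closure.
pose N y := W y `&` ~` bad y.
have Nnbhs y : Y y -> nbhs y (N y).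
  move=> Yy; apply: filterI; first by have [] := WP _ Yy.
  apply: open_nbhs_nbhs; split; first by rewrite openC.
  by move=> [n _ [C [_ nCy] Cy]].
have NY y z : Y y -> Y z -> N y z -> z = y.
  move=> Yy Yz [Wyz _]; have [_ WY] := WP _ Yy.
  have : (W y `&` Y) z by [].
  by rewrite WY.
pose U := [set C | B C /\
  (closure C `&` Y = set0 \/ exists y, [/\ Y y, C y & closure C `<=` N y])].
have Uone C : U C -> exists z, forall y, Y y -> closure C y -> y = z.
  move=> [_ [C0|[z [Yz _ CN]]]]; last by exists z => y Yy /CN; exact: NY.
  have [z _] := infinite_setN0 Yinf; exists z => y Yy Cy.
  by have : (closure C `&` Y) y by []; rewrite C0.
have Ucover : open_cover U.
  split=> [C [BC _]|]; first by case: bB => /(_ _ BC).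
  apply/seteqP; split=> // x _.
  have [Yx|nYx] := pselect (Y x).
    have [C [BC Cx CN]] := regular_basis_nbhs _ _ _ regX bB (Nnbhs _ Yx).
    by exists C => //; split=> //; right; exists x.
  have /(regular_basis_nbhs _ _ _ regX bB)[C [BC Cx CY]] : nbhs x (~` Y).
    by apply: open_nbhs_nbhs; split=> //; rewrite openC; case: Ycd.
  exists C => //; split=> //; left; apply/seteqP; split=> // z [/CY].
  by [].
have [V [VU Vcount Vstar]] := SL _ Ucover.
(* The fibres of an injection of [V] into the naturals are finite, so they list [V] by an element of
   [FinN B]. *)
have [v [vB vV]] : exists v, FinN B v /\ V `<=` \bigcup_n v n.
  have /countable_injP[i iI] := Vcount.
  exists (fun n => [set C | V C /\ i C = n]); split=> [n|C VC]; last by exists (i C).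
  split=> [|C [/VU[]]//]; apply: (@card_le_finite _ _ _ `I_n.+1 _ (finite_II _)).
  apply: (@card_le_inj _ _ _ _ i) => [C [_ /= ->]//|C C' /set_mem[VC _] /set_mem[VC' _]].
  by apply: iI; rewrite inE.
(* The closure of each member of [V] contains at most one point of [Y]. If no such [f] existed, [e]
   would inject all [f] above [v] into the countable image of [V] under [z]. *)
have [f [Df vf fV]] : exists f, [/\ D f, FinN_le v f &
    forall C, V C -> ~ closure C (e f)].
  apply: contrapT => nf; apply: (cofinal_FinN_uncountable _ _ _ Binf Dcof vB).
  have /choice[z zP] C : exists z, V C -> forall y, Y y -> closure C y -> y = z.
    have [/VU/Uone[z zC]|nVC] := pselect (V C); first by exists z.
    by have [z _] := infinite_setN0 Yinf; exists z => /nVC.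
  apply: (@sub_countable _ _ _ (z @` V)); last first.
    by apply: sub_countable Vcount; exact: card_image_le.
  apply: (@card_le_inj _ _ _ _ e) => [f [Df vf]|f f' /set_mem[Df _] /set_mem[Df' _]].
    apply: contrapT => nz; apply: nf; exists f; split=> // C VC Cf; apply: nz.
    by exists C => //; apply/esym/zP => //; exact: eY.
  by apply: eI; rewrite inE.
(* A member [C] of [U] containing [e f] lies in [N (e f)], hence misses [bad (e f)]; but its common
   point [x] with some [C'] in [V] lies in [bad (e f)], as [f] lists [C']. *)
have : star (\bigcup_(C in V) C) U (e f) by rewrite Vstar.
move=> [C [[BC UC] [x [[C' VC' C'x] Cx]]] Cef].
have Yef := eY _ Df.
case: UC => [C0|[y [Yy _ CN]]].
  have : (closure C `&` Y) (e f) by split=> //; exact: subset_closure.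
  by rewrite C0.
have yef : e f = y by apply: NY => //; exact/CN/subset_closure.
have [_] := CN _ (subset_closure Cx); apply.
have [n _ vn] := vV _ VC'; have [_ /(_ _ Df yef) gf] := gP y.
exists n => //; exists C'; last exact: subset_closure.
by split; [rewrite gf; exact: vf | rewrite -yef; exact: fV].
Qed.

(** For a constant sequence the omega-cover consists of a single star, which contains every
    singleton. *)
Lemma star_Ufin_star_Lindelof : star_Ufin_O_Omega X -> star_Lindelof X.
Proof.
move=> SU U Uc; have [V [VP [_ Vcov]]] := SU (fun=> U) (fun=> Uc).
exists (\bigcup_n V n); split.
- by move=> C [n _ /(proj2 (VP n))].
- by apply: bigcup_countable => // n _; apply: finite_set_countable; case: (VP n).
- rewrite bigcup_bigcup; apply/seteqP; split=> // x _.
  by have [_ [n _ <-] /(_ _ erefl)] := Vcov [set x] (finite_set1 x).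
Qed.

End star_Lindelof_closed_discrete.

(** * Real numbers and binary sequences *)

Section continuum.
Context {R : realType}.
Local Open Scope ring_scope.

(* Digits 0, 1 in base 3: unlike in base 2, distinct expansions differ in value. *)
Let tsum (s : nat -> bool) n : R := \sum_(i < n) (s i)%:R * 3^-1 ^+ i.

Let tsumS s n : tsum s n.+1 = tsum s n + (s n)%:R * 3^-1 ^+ n.
Proof. by rewrite /tsum big_ord_recr. Qed.

Let thirdX_gt0 n : 0 < 3^-1 ^+ n :> R.
Proof. by rewrite exprn_gt0// invr_gt0. Qed.

Let tsum_ge s m j : tsum s m <= tsum s (m + j).
Proof.
elim: j => [|j]; first by rewrite addn0.
move=> /le_trans; apply; rewrite addnS tsumS lerDl.
by rewrite mulr_ge0// ltW.
Qed.

Let tsum_le s m j : tsum s (m + j) <= tsum s m + 3 / 2 * 3^-1 ^+ m.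
Proof.
(* The geometric tail still to come, [3 / 2 * 3^-1 ^+ (m + j)], is subtracted to make the induction
   close. *)
suff : tsum s (m + j) <= tsum s m + 3 / 2 * 3^-1 ^+ m - 3 / 2 * 3^-1 ^+ (m + j).
  by have := thirdX_gt0 (m + j); lra.
elim: j => [|j]; first by rewrite addn0; lra.
rewrite addnS tsumS exprS; have := thirdX_gt0 (m + j).
by case: (s _) => /=; lra.
Qed.

Let tval s := sup (range (tsum s)).

Let tval_ge s n : tsum s n <= tval s.
Proof.
apply: ub_le_sup; last by exists n.
exists (tsum s 0 + 3 / 2 * 3^-1 ^+ 0) => _ [k _ <-].
by have := tsum_le s 0 k; rewrite add0n.
Qed.

Let tval_le s n : tval s <= tsum s n + 3 / 2 * 3^-1 ^+ n.
Proof.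
apply: ge_sup; first by exists (tsum s 0), 0%N.
by move=> _ [k _ <-]; rewrite (le_trans (tsum_ge s k n))// addnC tsum_le.
Qed.

(** The digit at [k] contributes [3^-1 ^+ k], while all later digits of [t] together contribute at
    most half of this. *)
Let tval_lt (s t : nat -> bool) k : (forall i, (i < k)%N -> s i = t i) -> s k -> ~~ t k ->
  tval t < tval s.
Proof.
move=> st sk ntk; have := tval_ge s k.+1; have := tval_le t k.+1.
rewrite !tsumS sk (negbTE ntk) exprS.
have -> : tsum s k = tsum t k by apply: eq_bigr => i _; rewrite st.
by have := thirdX_gt0 k; rewrite mul0r mul1r; lra.
Qed.

Lemma card_le_cantor_real : [set: nat -> bool] #<= [set: R].
Proof.
apply: (@card_le_inj _ _ _ _ tval) => // s t _ _ est; apply/funext => n.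
apply/eqP/negP => /negP nst.
have [k skt kmin] := ex_minnP (ex_intro (fun n => s n != t n) n nst).
have st i : (i < k)%N -> s i = t i.
  by move=> ik; apply/eqP; apply: contraTT ik => /kmin; rewrite -leqNgt.
have ts i : (i < k)%N -> t i = s i by move=> /st.
case sk: (s k) (t k =P true) skt => -[|/negP] tk; rewrite ?tk//.
- by have := tval_lt _ _ _ st sk tk; rewrite est ltxx.
- by have := tval_lt _ _ _ ts tk (negbT sk); rewrite est ltxx.
- by rewrite (negbTE tk).
Qed.

Lemma card_le_real_cantor : [set: R] #<= [set: nat -> bool].
Proof.
(* A real is coded by its Dedekind cut in the enumerated rationals. *)
pose c (x : R) n := if unpickle n is Some q then ratr q < x else false.
have clt x y : x < y -> c x <> c y.
  move=> /rat_in_itvoo[q]; rewrite in_itv/= => /andP[xq qy].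
  move=> /(congr1 (fun s => s (pickle q))); rewrite /c pickleK qy.
  by rewrite ltNge (ltW xq).
apply: (@card_le_inj _ _ _ _ c) => // x y _ _ cxy.
by case: (ltgtP x y) => // [/clt|/clt/nesym]; rewrite cxy.
Qed.

End continuum.

(* [f] is coded by the table whose entry [(n, k)] records whether [f n] has an
   element numbered [k], followed by the binary code of this element. *)
Lemma card_le_FinN_cantor {T} (A : set T) : A #<= [set: nat -> bool] ->
  FinN A #<= [set: nat -> bool].
Proof.
move=> /card_le_injfun[|i _ iI]; first by exists xpredT.
have /choice[e eP] F : exists e : T -> nat, finite_set F -> set_inj F e.
  have [/finite_set_countable/countable_injP[e eI]|nF] := pselect (finite_set F).
    by exists e.
  by exists (fun=> 0%N) => /nF.
pose table (f : nat -> set T) (p : nat * nat * nat) :=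
  `[< exists2 x, f p.1.1 x /\ e (f p.1.1) x = p.1.2 &
      if p.2 is m.+1 then i x m else true >].
pose code f n := if unpickle n is Some p then table f p else false.
have codeE f g : code f = code g -> table f =1 table g.
  by move=> fg p; have /(congr1 (fun s => s (pickle p))) := fg; rewrite /code pickleK.
have code_sub f g : FinN A f -> FinN A g -> code f = code g ->
    forall n, f n `<=` g n.
  move=> Af Ag /codeE fg n x fx.
  have [ffin fA] := Af n; have [gfin gA] := Ag n.
  (* The numbering depends on the set, so entry 0 only yields some [y] in [g n] with the number of
     [x]; the remaining entries show that [x] and [y] have the same binary code. *)
  have : table f (n, e (f n) x, 0%N) by apply/asboolP; exists x.
  rewrite fg => /asboolP[y [/= gy eyx] _].
  suff <- : y = x by [].
  apply: iI; rewrite ?inE; [exact: gA|exact: fA|].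
  apply/funext => m.
  have tf : table f (n, e (f n) x, m.+1) = i x m.
    apply/asboolP/idP => [[z [/= fz ez] izm]|ixm]; last by exists x.
    by rewrite -(eP _ ffin _ _ _ _ ez)// inE.
  have tg : table g (n, e (f n) x, m.+1) = i y m.
    apply/asboolP/idP => [[z [/= gz ez] izm]|iym]; last by exists y.
    by rewrite -(eP _ gfin z y)// ?inE// ez eyx.
  by rewrite -tf -tg fg.
apply: (@card_le_inj _ _ _ _ code) => // f g /set_mem Af /set_mem Ag fg.
by apply/funext => n; apply/seteqP; split; exact: code_sub.
Qed.

Theorem corollary4p10 (R : realType) (X : topologicalType)
    (regX : regular_space X) (T1X : accessible_space X) (PX : P_space X) :
  (star_Ufin_O_Omega X ->
     forall Y : set X, infinite_set Y -> closed_discrete Y ->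
       Y #< cof_FinN (weight X))
  /\
  (star_Lindelof X \/ star_Ufin_O_Omega X ->
     weight X #= [set: R] ->
     forall Y : set X, closed_discrete Y -> Y #< [set: R]).
Proof.
have [bX _] := weightP X.
have nle (Y : set X) D : star_Lindelof X -> infinite_set Y -> closed_discrete Y ->
    cofinal_in (FinN (weight X)) FinN_le D -> ~ (D #<= Y).
  by move=> SL Yinf Ycd; exact: star_Lindelof_cofinal_not_card_le.
split=> [SU Y Yinf Ycd|SL wR Y Ycd].
  have lexx f : FinN (weight X) f -> FinN_le f f by move=> _ n.
  have [cofw _] := cofP lexx.
  have := nle _ _ (star_Ufin_star_Lindelof SU) Yinf Ycd cofw.
  by split=> //; case: (card_le_total Y (cof_FinN (weight X))).
split; first by rewrite -(card_le_eqr wR); exact: closed_discrete_card_le_basis.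
move=> RY.
have {}SL : star_Lindelof X by case: SL => // /star_Ufin_star_Lindelof.
(* [Y] is infinite because, by the assumption [RY] to be refuted, the reals inject into it. *)
have Yinf : infinite_set Y.
  move=> /(card_le_finite RY); apply/infiniteP.
  apply: (@card_le_inj _ _ _ _ (fun n => n%:R : R)%R) => // m n _ _ /eqP.
  by rewrite eqr_nat => /eqP.
apply: (nle _ (FinN (weight X)) SL Yinf Ycd).
  by split=> // f; exists f => // n.
apply: card_le_trans RY; apply: card_le_trans card_le_cantor_real.
apply: card_le_FinN_cantor; rewrite (card_le_eql wR).
exact: card_le_real_cantor.
Qed.
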